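(* Let $X$ and $Y$ be topological spaces. If $X$ and $Y$ are strategically $k$-Rothberger, then $X\times Y$ is strategically $k$-Rothberger. In other words, the property of being strategically $k$-Rothberger is finitely productive.
   Context: No separation axioms are assumed on topological spaces. A $k$-cover of a space $Z$ is an open cover $\mathscr U$ of $Z$ such that every compact subset of $Z$ is contained in a member of $\mathscr U$; $\mathcal K_Z$ denotes the set of all $k$-covers of $Z$ (a $k$-cover is allowed to contain $Z$ itself). The $k$-Rothberger game on $Z$ is the following two-player game of length $\omega$: in round $n\in\omega$, P1 plays $\mathscr U_n\in\mathcal K_Z$ and P2 responds with $U_n\in\mathscr U_n$. P2 wins if $\{U_n:n\in\omega\}\in\mathcal K_Z$; otherwise P1 wins. A strategy for P2 is a function $\sigma$ assigning to each non-empty finite sequence $\langle\mathscr U_0,\dots,\mathscr U_n\rangle$ of elements of $\mathcal K_Z$ an element of $\mathscr U_n$; it is winning if $\{\sigma(\mathscr U_0,\dots,\mathscr U_n):n\in\omega\}\in\mathcal K_Z$ for every sequence $\langle\mathscr U_n:n\in\omega\rangle$ of elements of $\mathcal K_Z$. The space $Z$ is strategically $k$-Rothberger if P2 has a winning strategy in this game. *)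

(* Defs.v *)
From mathcomp Require Import all_boot all_order all_algebra.
From mathcomp Require Import all_classical all_reals all_analysis.

Set Implicit Arguments.
Unset Strict Implicit.
Unset Printing Implicit Defensive.

Local Open Scope classical_set_scope.

Definition is_k_cover (Z : topologicalType) (U : set (set Z)) : Prop :=
  [/\ forall A, U A -> open A,
      \bigcup_(A in U) A = setT
    & forall K, compact K -> exists2 A, U A & K `<=` A].

Definition k_cover (Z : topologicalType) : Type :=
  {U : set (set Z) | is_k_cover U}.

(* A non-empty finite sequence <U_0, ..., U_n> of k-covers is encoded as the
   pair of the sequence <U_0, ..., U_(n-1)> and its last term U_n. *)
Record strategy (Z : topologicalType) : Type := Strategy {
  response :> seq (k_cover Z) -> k_cover Z -> set Z;
  response_in : forall s U, sval U (response s U)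
}.

Definition winning (Z : topologicalType) (sigma : strategy Z) : Prop :=
  forall U : nat -> k_cover Z,
    is_k_cover (range (fun n => sigma (mkseq U n) (U n))).

Definition strategically_k_Rothberger (Z : topologicalType) : Prop :=
  exists sigma : strategy Z, winning sigma.

(* Main.v *)
Require Import Defs.
From mathcomp Require Import all_boot all_order all_algebra.
From mathcomp Require Import all_classical all_reals all_analysis.

(** By Galvin's duality, P2 wins the k-Rothberger game on Z iff P1 wins the
    compact-open game, in which P1 plays compact sets K_n, P2 answers with open
    sets U_n containing K_n, and P1 wins if the U_n form a k-cover.  In the
    latter game P1 can play the union of the moves prescribed by a winning
    strategy on all subsequences of the history; every subsequence of a play is
    then again a play against the original strategy, so each compact set lies in
    all but finitely many U_n.  Two strategies of this stronger kind can be run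
    in parallel on X and Y, using Wallace's tube lemma to turn the open superset
    of K_n x L_n chosen by P2 into an open box. *)

Set Implicit Arguments.
Unset Strict Implicit.
Unset Printing Implicit Defensive.

Local Open Scope classical_set_scope.

Section History.
Variables (A B : Type) (step : seq B -> A -> B).

(** Transfers a play from one game to another: each move is translated by [step] in view of the
    moves already translated. *)
Definition history (s : seq A) : seq B :=
  foldl (fun h a => rcons h (step h a)) [::] s.

Lemma history_mkseq (a : nat -> A) (n : nat) :
  history (mkseq a n) = mkseq (fun i => step (history (mkseq a i)) (a i)) n.
Proof.
elim: n => [//|n IHn].
by rewrite !mkseqS /history foldl_rcons -/(history _) -IHn.
Qed.

End History.

(** The exact length [phi k] makes the mask one of the bit tuples indexing the union in
    [compact_open_eventually]. *)
Lemma mask_mkseq_increasing (A : Type) (u : nat -> A) (phi : nat -> nat) (k : nat) :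
  {homo phi : i j / i < j} ->
  exists2 m : bitseq, size m = phi k &
    mkseq (u \o phi) k = mask m (mkseq u (phi k)).
Proof.
move=> phi_incr.
have /subseqP[m sz_m mE] : subseq (mkseq phi k) (iota 0 (phi k)).
  apply/(subseq_uniqP (iota_uniq _ _))/(irr_sorted_eq ltn_trans ltnn).
  - exact: homo_sorted (iota_ltn_sorted _ _).
  - exact/(sorted_filter ltn_trans)/iota_ltn_sorted.
  move=> i; rewrite mem_filter mem_iota add0n leq0n /=.
  apply/idP/idP => [ik|/andP[]//]; rewrite ik.
  by case/mapP: ik => j; rewrite mem_iota => jk ->; exact: phi_incr.
exists m; first by rewrite sz_m size_iota.
by rewrite /mkseq map_comp -/(mkseq _ _) mE map_mask.
Qed.

Lemma not_near_infty_subsequence (P : nat -> Prop) :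
  ~ (\forall n \near \oo, P n) ->
  exists2 phi : nat -> nat, {homo phi : i j / i < j} & forall k, ~ P (phi k).
Proof.
move=> nP.
have /choice[g gP] N : exists n, N <= n /\ ~ P n.
  apply: contrapT => noN; apply: nP; exists N => // n /= Nn.
  by apply: contrapT => nPn; apply: noN; exists n.
pose phi := fix phi k := if k is k'.+1 then g (phi k').+1 else g 0.
exists phi => [|[|k]]; [|exact: (gP _).2..].
by apply: homo_ltn => [|k]; [exact: ltn_trans | exact: (gP _).1].
Qed.

(** Compactness lets one small member of [G] serve all of [K]. A general filter is allowed because
    [tube] needs both the neighbourhoods of a point and those of a compact set. *)
Lemma near_compact_box (X Y : topologicalType) (G : set_system Y) (K : set X)
    (W : set (X * Y)) : ProperFilter G -> compact K ->
  (forall x, K x -> exists U V, [/\ nbhs x U, G V & U `*` V `<=` W]) ->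
  exists2 V, G V & forall x, K x -> nbhs x [set x' | forall y, V y -> W (x', y)].
Proof.
move=> FG /compact_near_coveringP cK boxW.
pose P (V : set Y) (x : X) := nbhs x [set x' | forall y, V y -> W (x', y)].
have /near_powerset_filter_fromP[|V GV KV] :
    \forall V \near powerset_filter_from G, K `<=` P V.
- apply: cK => x /boxW[U [V [Ux GV UVW]]].
  exists (U°, [set V' | V' `<=` V]) => [|[x' V'] [/= Ux' V'V]].
    by split; [exact: nbhs_interior | exact: small_set_sub].
  apply: filterS Ux' => x'' Ux'' y /V'V Vy; exact: UVW.
- move=> V V' VV' KV' x /KV'; apply: filterS => x' V'W y /VV'; exact: V'W.
- by exists V.
Qed.

Lemma tube (X Y : topologicalType) (K : set X) (L : set Y) (W : set (X * Y)) :
  compact K -> compact L -> open W -> K `*` L `<=` W ->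
  exists U V, [/\ open U /\ K `<=` U, open V /\ L `<=` V & U `*` V `<=` W].
Proof.
move=> cK cL oW KLW.
(* The neighbourhoods of [L] form a proper filter only if [L] is non-empty. *)
have [->|/set0P L0] := eqVneq L set0.
  exists setT, set0; split; [by split; [exact: openT|]| |by move=> ? []].
  by split; [exact: open0|].
have LG := set_nbhs_pfilter L0.
have [|V] := @near_compact_box _ _ (set_nbhs L) K W LG cK.
  move=> x Kx.
  (* For fixed [x] the factors are swapped: compactness of [L] yields one neighbourhood of [x] good
     for all of [L]. *)
  have [|U Ux LU] := @near_compact_box _ _ (nbhs x) L
      [set yx | W (yx.2, yx.1)] _ cL.
    move=> y Ly; have /(oW _)[[U V] /= [Ux Vy] UVW] : W (x, y) by exact: KLW.
    by exists V, U; split=> // -[y' x'] [] /= *; exact: UVW.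
  exists U, [set y | forall x', U x' -> W (x', y)]; split=> //.
  by move=> [x' y] /= [Ux' /(_ x')]; exact.
move=> /set_nbhsP[V' [oV' LV' V'V]] KV.
exists [set x | forall y, V y -> W (x, y)]°, V'; split=> //.
  by split; [exact: open_interior | move=> x /KV].
by move=> [x y] [/= /interior_subset xV /V'V]; exact: xV.
Qed.

Section CompactOpenGame.
Variable Z : topologicalType.

Definition compact_open_play (kappa : seq (set Z) -> set Z) (U : nat -> set Z) :=
  forall n, open (U n) /\ kappa (mkseq U n) `<=` U n.

Lemma k_cover_sub_range (U : nat -> set Z) : (forall n, open (U n)) ->
  (forall K, compact K -> exists n, K `<=` U n) -> is_k_cover (range U).
Proof.
move=> oU cU; split=> [_ [n _ <-]//||K /cU[n KU]]; last first.
  by exists (U n) => //; exists n.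
rewrite -subTset => z _; have [n zU] := cU _ (@compact_set1 _ z).
by exists (U n); [exists n | exact: zU].
Qed.

(* If no compact K worked, pick for each compact K an open superset that is
   never an answer: these sets form a k-cover, and the answer to it is one of
   them. *)
Lemma response_all_supersets (sigma : strategy Z) (s : seq (k_cover Z)) :
  exists2 K, compact K &
    forall U, open U -> K `<=` U -> exists C, sigma s C = U.
Proof.
apply: contrapT => noK.
pose bad := [set U : set Z | open U /\ forall C, sigma s C <> U].
have badP K : compact K -> exists2 U, bad U & K `<=` U.
  move=> cK; apply: contrapT => noU; apply: noK; exists K => // U oU KU.
  apply: contrapT => noC; apply: noU; exists U => //; split=> // C CU.
  by apply: noC; exists C.
have kbad : is_k_cover bad.
  split=> [U []//||//]; rewrite -subTset => z _.
  by have [U bU zU] := badP _ (@compact_set1 _ z); exists U => //; exact: zU.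
have /= [_] := response_in sigma s (exist _ bad kbad).
by move/(_ (exist _ bad kbad)).
Qed.

Lemma compact_open_of_Rothberger : strategically_k_Rothberger Z ->
  exists2 kappa, (forall s, compact (kappa s)) &
    forall U, compact_open_play kappa U -> is_k_cover (range U).
Proof.
move=> [sigma win].
have /choice[K KP] s : exists K, compact K /\
    forall U, open U -> K `<=` U -> exists C, sigma s C = U.
  by have [K] := response_all_supersets sigma s; exists K.
(* Default value of [F] at illegal moves. *)
have trivial_cover : k_cover Z.
  exists [set setT]; split=> [_ ->|| C _]; first exact: openT.
    by rewrite bigcup_set1.
  by exists setT.
have /choice[F FP] (sU : seq (k_cover Z) * set Z) : exists C,
    open sU.2 -> K sU.1 `<=` sU.2 -> sigma sU.1 C = sU.2.
  have [[oU KU]|nU] := pselect (open sU.2 /\ K sU.1 `<=` sU.2).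
    by have [C CU] := (KP sU.1).2 _ oU KU; exists C.
  by exists trivial_cover => oU KU; case: nU.
pose hist := history (fun h U => F (h, U)).
exists (K \o hist) => [s|U playU]; first exact: (KP _).1.
(* [F] recovers covers to which [sigma] answers exactly [U n], so [U] is the outcome of a play
   against [sigma]. *)
suff -> : U = fun n => sigma (mkseq (fun i => F (hist (mkseq U i), U i)) n)
                             (F (hist (mkseq U n), U n)) by exact: win.
apply/funext => n; have [oU KU] := playU n.
by rewrite -(history_mkseq (fun h U => F (h, U))) (FP (_, _)).
Qed.

Lemma compact_open_eventually (kappa : seq (set Z) -> set Z) :
  (forall s, compact (kappa s)) ->
  (forall U, compact_open_play kappa U -> is_k_cover (range U)) ->
  exists2 kappa', (forall s, compact (kappa' s)) &
    forall U, compact_open_play kappa' U ->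
    forall C, compact C -> \forall n \near \oo, C `<=` U n.
Proof.
move=> ckappa win.
(* The masks run through all subsequences of [s]; there are finitely many, so the union stays
   compact. *)
pose kappa' s := \big[setU/set0]_(m : (size s).-tuple bool) kappa (mask m s).
exists kappa' => [s|U playU C cC]; first by apply: bigsetU_compact.
apply: contrapT => /not_near_infty_subsequence[phi phi_incr nC].
have [|_ _ /(_ _ cC)[_ [k _ <-]]] := win (U \o phi); last exact: nC.
move=> k; have [oU kU] := playU (phi k); split=> //; apply: subset_trans kU.
have [m sz_m ->] := mask_mkseq_increasing U k phi_incr.
have sz : size m == size (mkseq U (phi k)) by rewrite size_mkseq sz_m.
by rewrite /kappa' (bigD1 (Tuple sz)) //=; exact: subsetUl.
Qed.

(** The easy half of the duality: P2 answers a k-cover by a member containing the compact set that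
    [kappa] prescribes. *)
Lemma Rothberger_of_compact_open (kappa : seq (set Z) -> set Z) :
  (forall s, compact (kappa s)) ->
  (forall U, compact_open_play kappa U -> is_k_cover (range U)) ->
  strategically_k_Rothberger Z.
Proof.
move=> ckappa win.
have /choice[f fP] (sC : seq (set Z) * k_cover Z) : exists U,
    sval sC.2 U /\ kappa sC.1 `<=` U.
  have [_ _ /(_ _ (ckappa sC.1))[U]] := svalP sC.2; by exists U.
pose hist := history (fun h C => f (h, C)).
exists (@Strategy Z (fun s C => f (hist s, C)) (fun s C => (fP (hist s, C)).1)).
move=> C /=; apply: win => n; split.
  have [+ _ _] := svalP (C n); apply; exact: (fP (_, _)).1.
by rewrite -(history_mkseq (fun h C => f (h, C))); exact: (fP (_, _)).2.
Qed.

End CompactOpenGame.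

Theorem theorem4p25 (X Y : topologicalType)
    (hX : strategically_k_Rothberger X) (hY : strategically_k_Rothberger Y) :
  strategically_k_Rothberger (X * Y)%type.
Proof.
have [kX0 ckX0 winX0] := compact_open_of_Rothberger hX.
have [kX ckX winX] := compact_open_eventually ckX0 winX0.
have [kY0 ckY0 winY0] := compact_open_of_Rothberger hY.
have [kY ckY winY] := compact_open_eventually ckY0 winY0.
pose K (h : seq (set X * set Y)) := kX (map fst h).
pose L (h : seq (set X * set Y)) := kY (map snd h).
have /choice[f fP] (hW : seq (set X * set Y) * set (X * Y)) : exists UV,
    open hW.2 -> K hW.1 `*` L hW.1 `<=` hW.2 ->
    [/\ open UV.1 /\ K hW.1 `<=` UV.1, open UV.2 /\ L hW.1 `<=` UV.2
      & UV.1 `*` UV.2 `<=` hW.2].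
  have [[oW KLW]|nW] := pselect (open hW.2 /\ K hW.1 `*` L hW.1 `<=` hW.2).
    have [U [V UVP]] := tube (ckX _) (ckY _) oW KLW.
    by exists (U, V).
  by exists (set0, set0) => oW KLW; case: nW.
pose hist := history (fun h W => f (h, W)).
apply: (@Rothberger_of_compact_open _ (fun s => K (hist s) `*` L (hist s))).
  by move=> s; apply: compact_setX; [exact: ckX | exact: ckY].
move=> W playW.
(* The box inside [W n]; its sides are the answers in the two auxiliary games on [X] and [Y]. *)
pose UV n := f (hist (mkseq W n), W n).
have histE n : hist (mkseq W n) = mkseq UV n by exact: history_mkseq.
have UVP n : [/\ open (UV n).1 /\ kX (mkseq (fst \o UV) n) `<=` (UV n).1,
                 open (UV n).2 /\ kY (mkseq (snd \o UV) n) `<=` (UV n).2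
               & (UV n).1 `*` (UV n).2 `<=` W n].
  have [oW KLW] := playW n.
  by have := fP (_, _) oW KLW; rewrite -/(UV n) /K /L /= histE /mkseq -!map_comp.
apply: k_cover_sub_range => [n|C cC]; first exact: (playW n).1.
have cC1 : compact (fst @` C).
  by apply/continuous_compact/cC/continuous_subspaceT => -[x y]; exact: cvg_fst.
have cC2 : compact (snd @` C).
  by apply/continuous_compact/cC/continuous_subspaceT => -[x y]; exact: cvg_snd.
have near1 : \forall n \near \oo, fst @` C `<=` (UV n).1.
  by apply: (winX (fst \o UV)) cC1 => n; have [] := UVP n.
have near2 : \forall n \near \oo, snd @` C `<=` (UV n).2.
  by apply: (winY (snd \o UV)) cC2 => n; have [] := UVP n.
(* Two cofinite sets of rounds meet; knowing only that each projection is covered in some round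
   would not give a common [n]. *)
have [n [C1 C2]] := filter_ex (filterI near1 near2).
have [_ _ UVW] := UVP n; exists n => z Cz; apply: UVW.
by split; [apply: C1 | apply: C2]; exists z.
Qed.
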